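(* Let $p_1,p_2>0$ with $p_1\ne p_2$, and set $$\alpha=\frac{1}{|p_1-p_2|}\left(p_1+p_2+\max\{2,2p_1p_2\}\right).$$ If the system $\ddot x(t)=u(t)$, $x(t)\in\mathbb{R}^N$, is controlled with $$u(t)=-(p_1+p_2)L\dot x(t)-p_1p_2L^2x(t),$$ where $L\in\mathbb{R}^{N\times N}$ is a graph Laplacian, then the resulting serial consensus system achieves scalable performance with constant $\alpha$ with respect to $e_p(t)=Lx(t)$ and $e_v(t)=\dot x(t)-v_{\mathrm{ref}}\mathbf{1}$, where $v_{\mathrm{ref}}\in\mathbb{R}$. That is, for every $N\ge 1$, every graph Laplacian $L\in\mathbb{R}^{N\times N}$, every $v_{\mathrm{ref}}\in\mathbb{R}$ and all initial conditions $x(0),\dot x(0)\in\mathbb{R}^N$, $$\sup_{t\ge 0}\left\|\begin{bmatrix}e_p(t)\\ e_v(t)\end{bmatrix}\right\|_\infty\le\alpha\left\|\begin{bmatrix}e_p(0)\\ e_v(0)\end{bmatrix}\right\|_\infty,$$ with $\alpha=\frac{1}{|p_1-p_2|}\left(p_1+p_2+\max\{2,2p_1p_2\}\right)$, which depends on neither $N$ nor $L$.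
   Context: Graph Laplacian: a matrix $L\in\mathbb{R}^{N\times N}$ is a (weighted, directed) graph Laplacian if there are weights $w_{i,j}\ge 0$ with $[L]_{i,j}=-w_{i,j}$ for $i\ne j$ and $[L]_{i,i}=\sum_{k\ne i}w_{i,k}$. $\mathbf 1$ is the all-ones vector and $\|z\|_\infty=\max_k|z_k|$. The scalar $v_{\mathrm{ref}}\in\mathbb{R}$ is the desired vehicle velocity; $e_p$ is the relative position error and $e_v$ the velocity deviation. Serial consensus system: with graph Laplacians $L_1,L_2$, the closed loop $\ddot x=u_{\mathrm{ref}}-(L_2+L_1)\dot x-L_2L_1x$, i.e. $(sI+L_2)(sI+L_1)X(s)=U_{\mathrm{ref}}(s)$ in the Laplace domain; here $L_1=p_1L$, $L_2=p_2L$, $u_{\mathrm{ref}}=0$. Scalable performance: a formation controller defined over a growing family of graphs $\{\mathcal G_N\}$ ($N$ being the number of agents) achieves scalable performance if $\sup_{t\ge0}\left\|\begin{bmatrix}e_p(t)\\ e_v(t)\end{bmatrix}\right\|_\infty\le\alpha\left\|\begin{bmatrix}e_p(0)\\ e_v(0)\end{bmatrix}\right\|_\infty$ with $\alpha$ fixed and independent of $N$. *)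

(* Defs.v *)
From HB Require Import structures.
From mathcomp Require Import all_boot all_order all_algebra.
From mathcomp Require Import all_classical all_reals all_analysis.
Export numFieldNormedType.Exports.

Set Implicit Arguments.
Unset Strict Implicit.
Unset Printing Implicit Defensive.

Import Order.TTheory GRing.Theory Num.Theory.
Local Open Scope classical_set_scope.
Local Open Scope ring_scope.

(* The diagonal of [w] is never used, so it need not be constrained to 0. *)
Definition graph_laplacian (R : realType) (N : nat) (L : 'M[R]_N) : Prop :=
  exists w : 'I_N -> 'I_N -> R,
    [/\ forall i j, 0 <= w i j,
        forall i j, i != j -> L i j = - w i j
      & forall i, L i i = \sum_(k < N | k != i) w i k].

(* x'' = u as an initial value problem on [0, +oo[, with velocity v = x'.  The
   trajectories are functions on R, but only their values at t >= 0 are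
   constrained: x and v are continuous on [0, +oo[ (one-sidedly at 0), so that
   x 0 and v 0 are the initial conditions, and the differential equations hold
   at every t > 0. *)
Definition double_integrator (R : realType) (N : nat)
    (x v u : R -> 'cV[R]_N) : Prop :=
  [/\ {within [set t : R | 0 <= t], continuous x},
      {within [set t : R | 0 <= t], continuous v},
      forall t : R, 0 < t -> is_derive t 1 x (v t)
    & forall t : R, 0 < t -> is_derive t 1 v (u t)].

(* Time-domain form of (sI + L2) (sI + L1) X(s) = U_ref(s); v is x'. *)
Definition serial_consensus (R : realType) (N : nat) (L1 L2 : 'M[R]_N)
    (uref x v : R -> 'cV[R]_N) : Prop :=
  double_integrator x v
    (fun t => uref t - (L2 + L1) *m v t - (L2 *m L1) *m x t).

(* A state feedback (or a state output), given by one formula for all numbers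
   N of agents, all Laplacians L, all positions x and all velocities v. *)
Definition feedback_family (R : realType) : Type :=
  forall N : nat, 'M[R]_N -> 'cV[R]_N -> 'cV[R]_N -> 'cV[R]_N.

(* [G N] is the set of Laplacians of the admissible graphs on N agents.  The
   norm of the library on matrices is the maximum of the absolute values of the
   entries, i.e. the infinity norm on column vectors.  The supremum is taken in
   the extended reals, so that an unbounded trajectory violates the bound. *)
Definition scalable_performance (R : realType)
    (G : forall N : nat, set 'M[R]_N) (ctrl e_p e_v : feedback_family R)
    (alpha : R) : Prop :=
  forall (N : nat) (L : 'M[R]_N), (0 < N)%N -> G N L ->
  forall x v : R -> 'cV[R]_N,
    double_integrator x v (fun t => ctrl N L (x t) (v t)) ->
    let e t := col_mx (e_p N L (x t) (v t)) (e_v N L (x t) (v t)) in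
    (ereal_sup [set `|e t|%:E | t in [set t : R | (0 <= t)%R]]
      <= (alpha * `|e 0|)%:E)%E.

(* Main.v *)
Require Import Defs.
From HB Require Import structures.
From mathcomp Require Import all_boot all_order all_algebra.
From mathcomp Require Import all_classical all_reals all_analysis.
From mathcomp Require Import ring lra.

Set Implicit Arguments.
Unset Strict Implicit.
Unset Printing Implicit Defensive.

Import Order.TTheory GRing.Theory Num.Theory.
Import numFieldNormedType.Exports.
Local Open Scope classical_set_scope.
Local Open Scope ring_scope.

(* With e_p = L x, the combination y = e_v + p1 e_p obeys y' = - p2 L y, and
   symmetrically for e_v + p2 e_p.  By a maximum principle, these first-order
   consensus flows do not increase the infinity norm.  Since p1 and p2 differ,
   e_p and e_v are recovered from the two modes as linear combinations with
   coefficients +-1, +-p1, +-p2 divided by p1 - p2. *)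

(** * Matrix norms and derivatives of vector-valued functions *)

Lemma ler_norm_mx (R : realDomainType) m n (A : 'M[R]_(m, n)) i j :
  `|A i j| <= `|A|.
Proof. by rewrite [leRHS]mx_normrE; exact: (le_bigmax _ _ (i, j)). Qed.

Lemma mx_norm_le (R : realDomainType) m n (A : 'M[R]_(m, n)) (b : R) :
  0 <= b -> (forall i j, `|A i j| <= b) -> `|A| <= b.
Proof.
by move=> b0 Ab; rewrite [leLHS]mx_normrE; apply: bigmax_le => // -[i j] _.
Qed.

Lemma continuous_mulmx (R : realFieldType) m n p (A : 'M[R]_(m, n)) :
  continuous (mulmx A : 'M[R]_(n, p) -> 'M[R]_(m, p)).
Proof.
apply: bounded_linear_continuous; apply/linear_boundedP; near=> r => B.
(* The sum of all [|A i j|] dominates every row sum of absolute values, hence the operator norm of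
   [A] for the sup norm. *)
have Ar : \sum_i \sum_j `|A i j| <= r by near: r; exact: nbhs_pinfty_ge.
have A0 i : 0 <= \sum_j `|A i j| by apply: sumr_ge0.
apply: mx_norm_le => [|i k].
  by rewrite mulr_ge0// (le_trans _ Ar)// sumr_ge0.
apply: le_trans (ler_wpM2r (normr_ge0 B) Ar).
rewrite mxE (le_trans (ler_norm_sum _ _ _))// (bigD1 i)//= mulrDl.
rewrite -[leLHS]addr0 lerD ?mulr_ge0 ?sumr_ge0//.
by rewrite mulr_suml ler_sum// => j _; rewrite normrM ler_wpM2l// ler_norm_mx.
Unshelve. all: by end_near. Qed.

Lemma is_derive_linear (R : numFieldType) (V W : normedModType R)
    (f : {linear V -> W}) (g : R -> V) (t : R) (d : V) :
  continuous f -> is_derive t 1 g d -> is_derive t 1 (f \o g) (f d).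
Proof.
move=> cf [dg Dg].
have fgd : h^-1 *: ((f \o g) (h *: 1 + t) - (f \o g) t) @[h --> 0^'] --> f d.
  under eq_fun do rewrite /= -linearB -linearZ.
  by rewrite -Dg; apply: continuous_cvg; [exact: cf|exact: dg].
by apply: DeriveDef; [apply/cvg_ex; exists (f d)|exact/cvg_lim].
Qed.

Lemma is_derive_coord (R : realFieldType) m n (M : R -> 'M[R]_(m, n))
    (t : R) D i j :
  is_derive t 1 M D -> is_derive t 1 (fun s => M s i j) (D i j).
Proof.
case=> dM DM; apply: DeriveDef; first exact: (derivable_mxP _ _ _).1.
by rewrite -DM derive_mx// mxE.
Qed.

(** Difference quotients from the left have a nonpositive numerator and a negative denominator.
    Using the left side alone covers a maximum at the right end of the time interval. *)
Lemma is_derive_left_max_ge0 (R : realFieldType) (f : R -> R) (t d : R) :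
  0 < t -> is_derive t 1 f d -> (forall s, 0 <= s <= t -> f s <= f t) -> 0 <= d.
Proof.
move=> t0 [df <-] ft.
have Df : h^-1 *: (f (h *: 1 + t) - f t) @[h --> 0^'-] --> 'D_1 f t.
  apply: cvg_trans df; apply: cvg_app => A [e e0 Ae].
  by exists e => // h eh h0; apply: Ae => //; rewrite lt_eqF.
apply: (cvgr_to_ge Df); near=> h.
have h0 : h < 0 by near: h; exact: nbhs_left_lt.
(* This keeps [h + t] inside [[0, t]], where [f t] is maximal. *)
have ht : - t < h by near: h; apply: nbhs_left_gt; rewrite oppr_lt0.
rewrite mulr_le0 ?invr_le0 ?(ltW h0)// subr_le0 [_ *: 1]mulr1 ft//.
by apply/andP; split; lra.
Unshelve. all: by end_near. Qed.

(** * Maximum principle for Laplacian flows *)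

Section laplacian.
Variables (R : realType) (N : nat) (L : 'M[R]_N).
Hypothesis lapL : graph_laplacian L.

Lemma graph_laplacianZ (c : R) : 0 <= c -> graph_laplacian (c *: L).
Proof.
case: lapL => w [w0 wL wd] c0; exists (fun i j => c * w i j); split.
- by move=> i j; rewrite mulr_ge0.
- by move=> i j ij; rewrite mxE wL// mulrN.
- by move=> i; rewrite mxE wd mulr_sumr.
Qed.

(** Entry [i] of [L *m z] is the sum over [k != i] of [w i k * (z i 0 - z k 0)], and each term is
    nonnegative at a maximal entry. *)
Lemma mul_laplacian_max_ge0 (z : 'cV[R]_N) i :
  (forall k, z k 0 <= z i 0) -> 0 <= (L *m z) i 0.
Proof.
case: lapL => w [w0 wL wd] zi.
rewrite mxE (bigD1 i)//= wd mulr_suml -big_split/=; apply: sumr_ge0 => k ki.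
by rewrite wL 1?eq_sym// mulNr -mulrBr mulr_ge0// subr_ge0.
Qed.

Lemma mul_laplacian_const (c : R) : L *m const_mx c = 0 :> 'cV_N.
Proof.
case: lapL => w [_ wL wd]; apply/colP => i.
rewrite !mxE (bigD1 i)//= wd mxE mulr_suml -big_split/= big1// => k ki.
by rewrite wL 1?eq_sym// !mxE mulNr addrN.
Qed.

Section flow.
Variable z : R -> 'cV[R]_N.
Hypothesis cz : {within [set t : R | 0 <= t], continuous z}.
Hypothesis dz : forall t : R, 0 < t -> is_derive t 1 z (- (L *m z t)).

(* Perturbing z by - e s makes the maximum principle strict: a maximum of
   z s k 0 - e s over all k and all s in [0, t] cannot be at a time s > 0, where
   the derivative - (L z) k 0 - e is negative. *)
Lemma laplacian_flow_le_eps (M e t : R) i : 0 < e -> 0 <= t ->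
  (forall k, z 0 k 0 <= M) -> z t i 0 <= M + e * t.
Proof.
move=> e0 t0 zM.
pose f k s := z s k 0 - e * s.
have cf k : {within `[0, t], continuous (f k)}.
  apply: within_continuousB.
    apply: (@within_continuous_comp _ _ _ _ z (fun A : 'cV_N => A k 0)).
      by move=> A _; exact: coord_continuous.
    apply: continuous_subspaceW cz => s /=.
    by rewrite in_itv => /andP[].
  apply: continuous_subspaceT => s.
  exact: mulrl_continuous.
(* Maximise in two stages: over time for each coordinate, by compactness, then over the finitely
   many coordinates. *)
have /choice[c cP] : forall k, exists c, c \in `[0, t]%R /\
    forall s, s \in `[0, t]%R -> f k s <= f k c.
  by move=> k; have [c ? ?] := EVT_max t0 (cf k); exists c.
case: (@arg_maxP _ _ _ i xpredT (fun k => f k (c k))) => // k _ kmax.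
have fck j s : s \in `[0, t]%R -> f j s <= f k (c k).
  by move=> st; apply: le_trans (kmax j isT); apply: (cP j).2.
have [ck0 ckt] : 0 <= c k /\ c k <= t.
  by apply/andP; have := (cP k).1; rewrite in_itv.
have : f i t <= f k (c k) by apply: fck; rewrite in_itv/= t0 lexx.
move: ck0; rewrite le_eqVlt => /predU1P[ck0|ck0].
  by have := zM k; rewrite -ck0 /f mulr0; lra.
have dfk : is_derive (c k) 1 (f k) (- (L *m z (c k)) k 0 - e).
  apply: is_derive_eq; first exact: is_deriveB (is_derive_coord k 0 (dz ck0)) _.
  by rewrite mxE [e *: 1]mulr1.
have : 0 <= - (L *m z (c k)) k 0 - e.
  apply: (is_derive_left_max_ge0 ck0 dfk) => s /andP[s0 sc].
  by apply: fck; rewrite in_itv/= s0 (le_trans sc).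
suff : 0 <= (L *m z (c k)) k 0 by lra.
(* The perturbation is the same for all coordinates, so at the fixed time [c k] comparing [f j] with
   [f k] compares the entries of [z]. *)
apply: mul_laplacian_max_ge0 => j.
have := fck j (c k); rewrite (cP k).1 => /(_ isT).
by rewrite /f lerD2r.
Qed.

Lemma laplacian_flow_le (M t : R) i : 0 <= t ->
  (forall k, z 0 k 0 <= M) -> z t i 0 <= M.
Proof.
move=> t0 zM; apply/ler_addgt0Pr => e e0.
(* The slope is taken to be [e / (t + 1)]: it makes sense at [t = 0] too, and its drift up to time
   [t] is at most [e]. *)
have t1 : 0 < t + 1 by rewrite ltr_wpDl.
apply: (le_trans (laplacian_flow_le_eps i (divr_gt0 e0 t1) t0 zM)).
rewrite lerD2l mulrAC ler_pdivrMr// ler_pM2l//; lra.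
Qed.

End flow.

Lemma laplacian_flow_norm_le (z : R -> 'cV[R]_N) (t : R) :
  {within [set t : R | 0 <= t], continuous z} ->
  (forall t : R, 0 < t -> is_derive t 1 z (- (L *m z t))) ->
  0 <= t -> `|z t| <= `|z 0|.
Proof.
move=> cz dz t0; apply: mx_norm_le => // i j; rewrite (ord1 j) ler_norml.
apply/andP; split.
  (* By linearity [- z] follows the same flow, so the upper bound for it is the lower bound for
     [z]. *)
  suff : (- z t) i 0 <= `|z 0| by rewrite mxE lerNl.
  apply: (@laplacian_flow_le (fun s => - z s)) => // [s|s s0|k].
  - exact: (continuousN (cz s)).
  - by rewrite mulmxN; apply: is_deriveN; exact: dz.
  - rewrite mxE (le_trans (ler_norm _))// normrN; exact: ler_norm_mx.
apply: laplacian_flow_le => // k.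
by rewrite (le_trans (ler_norm _))// ler_norm_mx.
Qed.

End laplacian.

(** * The modes of the closed loop *)

Section serial.
Variables (R : realType) (N : nat) (L : 'M[R]_N) (p1 p2 vref : R).
Hypothesis lapL : graph_laplacian L.
Variables x v : R -> 'cV[R]_N.
Hypothesis dxv : double_integrator x v
  (fun t => - ((p1 + p2) *: (L *m v t)) - (p1 * p2) *: (L ^+ 2 *m x t)).

Let y s := v s - const_mx vref + p1 *: (L *m x s).

(** Adding [p1 *: (L *m v)] to the control leaves [- p2 *: L *m (v + p1 *: (L *m x))]. Since [L]
    kills constant vectors, [vref] can be inserted, and [y] follows the flow of the Laplacian
    [p2 *: L]. *)
Lemma serial_mode_norm_le (t : R) : 0 <= p2 -> 0 <= t -> `|y t| <= `|y 0|.
Proof.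
move=> p20 t0; have [cx cv dx dv] := dxv.
apply: (laplacian_flow_norm_le (graph_laplacianZ lapL p20)) => // [s|s s0].
  apply: cvgD; first by apply: cvgB; [exact: cv|exact: cvg_cst].
  apply: cvgZl_tmp.
  exact: (continuous_cvg _ (@continuous_mulmx _ _ _ _ L _) (cx s)).
have dLx := is_derive_linear (@continuous_mulmx _ _ _ 1 L) (dx s s0).
have dev := is_deriveB (dv s s0) (is_derive_cst (const_mx vref) s 1).
have dy := is_deriveD dev (is_deriveZ p1 dLx).
apply: (is_derive_eq dy) => /=.
rewrite -scalemxAl mulmxDr mulmxBr (mul_laplacian_const lapL) -scalemxAr.
rewrite expr2 -mulmxE -mulmxA !subr0.
move: (L *m v s) (L *m (L *m x s)) => a b.
by apply/colP => i; rewrite !mxE; ring.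
Qed.

End serial.

(** * Recovering the errors from the modes *)

Lemma norm_col_mx (R : realDomainType) m1 m2 n (A : 'M[R]_(m1, n))
    (B : 'M[R]_(m2, n)) : `|col_mx A B| = Num.max `|A| `|B|.
Proof.
apply/le_anti/andP; split.
  apply: mx_norm_le => [|i j]; first by rewrite le_max normr_ge0.
  by rewrite mxE; case: fintype.split => k; rewrite le_max ler_norm_mx ?orbT.
rewrite ge_max; apply/andP; split; apply: mx_norm_le => // i j.
  by rewrite -(col_mxEu A B) ler_norm_mx.
by rewrite -(col_mxEd A B) ler_norm_mx.
Qed.

(** Each mode is initially at most [(1 + p) * E]. The difference of the modes then gives
    [(1 + p1) + (1 + p2)], and their combination with weights [p1] and [p2] gives
    [p1 * (1 + p2) + p2 * (1 + p1)]; these are the two cases of the maximum in [alpha]. *)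
Lemma decoupled_norm_le (R : realFieldType) (V : normedModType R) (p1 p2 E : R)
    (ep0 ev0 ep ev : V) :
  0 < p1 -> 0 < p2 -> p1 != p2 -> `|ep0| <= E -> `|ev0| <= E ->
  `|ev + p1 *: ep| <= `|ev0 + p1 *: ep0| ->
  `|ev + p2 *: ep| <= `|ev0 + p2 *: ep0| ->
  `|ep| <= `|p1 - p2|^-1 * (p1 + p2 + 2) * E /\
  `|ev| <= `|p1 - p2|^-1 * (p1 + p2 + 2 * p1 * p2) * E.
Proof.
move=> p10 p20 p12 epE evE.
have y0 p : 0 < p -> `|ev0 + p *: ep0| <= (1 + p) * E.
  move=> p0; rewrite (le_trans (ler_normD _ _))// normrZ gtr0_norm//.
  by rewrite mulrDl mul1r lerD// ler_pM2l.
move=> /le_trans/(_ (y0 _ p10)) y1 /le_trans/(_ (y0 _ p20)) y2.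
have d0 : 0 < `|p1 - p2| by rewrite normr_gt0 subr_eq0.
rewrite -!mulrA !ler_pdivlMl// -!normrZ; split.
  have -> : (p1 - p2) *: ep = (ev + p1 *: ep) - (ev + p2 *: ep).
    by rewrite opprD addrACA subrr add0r scalerBl.
  by rewrite (le_trans (ler_normB _ _))//; lra.
have -> : (p1 - p2) *: ev = p1 *: (ev + p2 *: ep) - p2 *: (ev + p1 *: ep).
  by rewrite !scalerDr !scalerA mulrC opprD addrACA subrr addr0 scalerBl.
rewrite (le_trans (ler_normB _ _))// !normrZ !gtr0_norm//.
have := ler_wpM2l (ltW p10) y2; have := ler_wpM2l (ltW p20) y1; lra.
Qed.

Theorem theorem2 (R : realType) (p1 p2 : R)
    (hp1 : 0 < p1) (hp2 : 0 < p2) (hp : p1 != p2) :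
  let alpha : R :=
    1 / `|p1 - p2| * (p1 + p2 + Num.max 2 (2 * p1 * p2)) in
  let ctrl : feedback_family R := fun N L x v =>
    - ((p1 + p2) *: (L *m v)) - (p1 * p2) *: (L ^+ 2 *m x) in
  (forall (N : nat) (L : 'M[R]_N) (x v : R -> 'cV[R]_N),
      (0 < N)%N -> graph_laplacian L ->
      double_integrator x v (fun t => ctrl N L (x t) (v t)) ->
      serial_consensus (p1 *: L) (p2 *: L) (fun=> 0) x v) /\
  (forall vref : R,
      scalable_performance (@graph_laplacian R) ctrl
        (fun N L x v => L *m x)
        (fun N L x v => v - const_mx vref)
        alpha).
Proof.
move=> alpha ctrl; split=> [N L x v _ _ [cx cv dx dv]|vref N L _ lapL x v dxv].
  split=> // t t0; apply: (is_derive_eq (dv t t0)).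
  rewrite add0r -scalerDl -!scalemxAl -scalemxAr -scalemxAl scalerA.
  by rewrite (addrC p2) (mulrC p2) /ctrl expr2.
set e := fun t => col_mx _ _; set E := `|e 0|.
have Ee : Num.max `|L *m x 0| `|v 0 - const_mx vref| <= E.
  by rewrite -norm_col_mx.
move: Ee; rewrite ge_max => /andP[epE evE].
apply: ge_ereal_sup => _ [t /= t0 <-]; rewrite lee_fin norm_col_mx ge_max.
have y1 := serial_mode_norm_le vref lapL dxv (ltW hp2) t0.
have y2 : `|v t - const_mx vref + p2 *: (L *m x t)| <=
          `|v 0 - const_mx vref + p2 *: (L *m x 0)|.
  (* The control is symmetric in [p1] and [p2], so exchanging them yields the second mode. *)
  apply: (@serial_mode_norm_le _ _ _ p2 p1) => //; last exact: ltW.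
  by rewrite addrC (mulrC p2).
have [ept evt] := decoupled_norm_le hp1 hp2 hp epE evE y1 y2.
have E0 : 0 <= E by exact: normr_ge0.
have d0 : 0 <= `|p1 - p2|^-1 by rewrite invr_ge0.
rewrite /alpha div1r (le_trans ept) ?(le_trans evt)//.
  by rewrite ler_wpM2r// ler_wpM2l// lerD2l le_max lexx orbT.
by rewrite ler_wpM2r// ler_wpM2l// lerD2l le_max lexx.
Qed.
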